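(* Let $ABCD$ be a parallelogram with center $O$ (the intersection of its diagonals), and let $f\colon ABCD\to\mathbb{R}$ be a function whose restrictions to the triangles $AOB$, $BOC$, $COD$ and $DOA$ are convex. Let $A'B'C'D'=h_O^{2/3}(ABCD)$ (i.e. $A'=h_O^{2/3}(A)$, etc.), and let $KL=h_D^{2/3}(AO)$, $LM=h_D^{2/3}(OC)$, $PQ=h_B^{2/3}(AO)$, $QR=h_B^{2/3}(OC)$. Then $$\frac{\operatorname{Avg}(f,KL)+\operatorname{Avg}(f,LM)+\operatorname{Avg}(f,PQ)+\operatorname{Avg}(f,QR)}{4}\le\operatorname{Avg}(f,ABCD),$$ $$\frac{\operatorname{Avg}(f,A'B')+\operatorname{Avg}(f,B'C')+\operatorname{Avg}(f,C'D')+\operatorname{Avg}(f,D'A')}{4}\le\operatorname{Avg}(f,ABCD).$$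
   Context: $h_{\mathbf a}^\lambda$ denotes the homothety with center $\mathbf a$ and ratio $\lambda$: $h_{\mathbf a}^\lambda(\mathbf x)=\mathbf a+\lambda(\mathbf x-\mathbf a)$. For a set $U$ which is a $k$-dimensional object (segment, polygon) and an integrable $f$, $\operatorname{Avg}(f,U)=\frac{1}{\operatorname{Vol}_k(U)}\int_U f$, with $\operatorname{Vol}_k$ the $k$-dimensional measure (length, area). For points $X,Y,\dots$, $\operatorname{Avg}(f,XY\dots)$ means $\operatorname{Avg}(f,\operatorname{conv}\{X,Y,\dots\})$. *)

(* Defs.v *)
From HB Require Import structures.
From mathcomp Require Import all_boot all_order all_algebra.
From mathcomp Require Import all_classical all_reals all_analysis.
Set Implicit Arguments. Unset Strict Implicit. Unset Printing Implicit Defensive.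
Import Order.TTheory GRing.Theory Num.Theory.
Local Open Scope classical_set_scope.
Local Open Scope ring_scope.

Section Geom.
Variable R : realType.
Definition pt := (R * R)%type.

Definition homothety (a : pt) (l : R) (x : pt) : pt := a + l *: (x - a).

Definition triangle (a b c : pt) : set pt :=
  [set x | exists s t u : R, [/\ 0 <= s, 0 <= t, 0 <= u, s + t + u = 1 &
                                x = s *: a + t *: b + u *: c]].

(* convex hull of the parallelogram ABCD (with C = B + D - A): A + s(B-A) + t(D-A) *)
Definition parallelogram_region (a b d : pt) : set pt :=
  [set x | exists s t : R, [/\ 0 <= s <= 1, 0 <= t <= 1 & x = a + s *: (b - a) + t *: (d - a)]].

Definition convex_on (S : set pt) (f : pt -> R) : Prop :=
  forall x y, S x -> S y -> forall t : R, 0 <= t <= 1 ->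
    f ((1 - t) *: x + t *: y) <= (1 - t) * f x + t * f y.

Definition leb2 := ((@lebesgue_measure R) \x (@lebesgue_measure R))%E.

Definition avg2 (U : set pt) (f : pt -> R) : R :=
  Rintegral leb2 U f / fine (leb2 U).

(* Avg(f, PQ) over the segment [P,Q]: (1/|PQ|) int_{PQ} f ds, written via the
   arc-length parametrization s = t |PQ|, t in [0,1]. *)
Definition avg_seg (p q : pt) (f : pt -> R) : R :=
  Rintegral (@lebesgue_measure R) `[0, 1]%classic (fun t => f (p + t *: (q - p))).
End Geom.

(* Main.v *)
Require Import Defs.
From HB Require Import structures.
From mathcomp Require Import all_boot all_order all_algebra.
From mathcomp Require Import all_classical all_reals all_analysis.
From mathcomp Require Import measurable_realfun ring lra.
Import Order.TTheory GRing.Theory Num.Theory numFieldNormedType.Exports.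
Local Open Scope classical_set_scope.
Local Open Scope ring_scope.
Set Implicit Arguments.
Unset Strict Implicit.

(** Each open triangle [XYZ] among [AOB], [BOC], [COD], [DOA] is swept from a vertex [X]
    by the rays to the points of the opposite side.  In the coordinates
    [p = X + u (Y - X) + v (Z - Y)], [0 < v < u < 1], the blow-up [v = u t] turns
    [du dv] into [u du dt], and [2 u du] is a probability measure on [0, 1] with mean
    [2/3]; Jensen's inequality along each ray therefore bounds the average of the convex
    function [f] over [XYZ] below by its average over the homothetic segment
    [h_X^(2/3) (YZ)].  The four triangles have equal areas, so averaging this over them,
    with apices [D], [D], [B], [B] on the one hand and apex [O] on the other, gives the
    two inequalities.  Since [f] is only assumed convex, its measurability is part of the
    proof: a convex function on a simplex is upper semicontinuous up to the boundary. *)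

(** * Affine change of variable on the line *)

Section AffineSubstitution.
Variable R : realType.
Local Notation mu := (@lebesgue_measure R).
Implicit Types (a b c p q r s : R).

Lemma measurable_affine a b :
  measurable_fun [set: R] (fun x : R => a * x + b).
Proof. by apply: measurable_funD => //; exact: measurable_funM. Qed.

(** Lebesgue measure is determined by its values on half-open intervals, so only these need
    checking. A negative [a] moves the closed end to the left, which does not affect the length. *)
Lemma lebesgue_measure_affine_preimage a b x y : a != 0 -> x <= y ->
  (`|a|%:E * mu ((fun t : R => a * t + b)%R @^-1` `]x, y]%classic) = (y - x)%:E)%E.
Proof.
move=> a0 xy.
have aV t z : (a * t + b = z) <-> t = (z - b) / a.
  by split=> [<-|->]; field.
have [a_gt0|a_le0] := ltP 0 a.
  have -> : (fun t : R => a * t + b) @^-1` `]x, y]%classic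
      = `](x - b) / a, (y - b) / a]%classic.
    apply/seteqP; split => t /=; rewrite !in_itv/=.
      by rewrite ltr_pdivrMr// ler_pdivlMr// => /andP[? ?]; apply/andP; lra.
    by rewrite ltr_pdivrMr// ler_pdivlMr// => /andP[? ?]; apply/andP; lra.
  rewrite lebesgue_measure_itv/= lte_fin ltr_pM2r ?invr_gt0//.
  rewrite ltrD2r gtr0_norm//; case: ltP => [_|yx].
    by rewrite -EFinD -EFinM; congr EFin; field.
  by rewrite mule0 (_ : y - x = 0)//; lra.
have a_lt0 : a < 0 by rewrite lt_neqAle a0.
have -> : (fun t : R => a * t + b) @^-1` `]x, y]%classic
    = `[(y - b) / a, (x - b) / a[%classic.
  apply/seteqP; split => t /=; rewrite !in_itv/=.
    by rewrite ltr_ndivlMr// ler_ndivrMr// => /andP[? ?]; apply/andP; lra.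
  by rewrite ltr_ndivlMr// ler_ndivrMr// => /andP[? ?]; apply/andP; lra.
rewrite lebesgue_measure_itv/= lte_fin ltr_nM2r ?invr_lt0//.
rewrite ltrD2r ltr0_norm//; case: ltP => [_|yx].
  by rewrite -EFinD -EFinM; congr EFin; field.
by rewrite mule0 (_ : y - x = 0)//; lra.
Qed.

(** The pushforward of Lebesgue measure by [t -> a t + b], scaled by [|a|], agrees with Lebesgue
    measure on the intervals []x, y]], hence equals it by uniqueness. *)
Lemma ge0_integral_affine (f : R -> \bar R) a b : a != 0 ->
  measurable_fun [set: R] f -> (forall x, 0 <= f x)%E ->
  (\int[mu]_x f x = `|a|%:E * \int[mu]_x f (a * x + b)%R)%E.
Proof.
move=> a0 mf f0.
have mphi := measurable_affine a b.
pose nu : {measure set (measurableTypeR R) -> \bar R} :=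
  pushforward mu (fun t : R => a * t + b : measurableTypeR R).
have k0 : 0 <= `|a| by [].
pose k : {nonneg R} := NngNum k0.
transitivity (\int[mscale k (nu mphi)]_x f x)%E.
  apply: eq_measure_integral => A mA _.
  apply: lebesgue_measure_unique => //= _ [[x y]] /= _ <-.
  rewrite /mscale/= /nu /pushforward; have [xy|yx] := leP x y; last first.
    by rewrite set_itv_ge ?bnd_simp -?leNgt ?ltW// preimage_set0 !measure0 mule0.
  rewrite lebesgue_measure_affine_preimage// lebesgue_measure_itv/= lte_fin.
  by move: xy; rewrite le_eqVlt => /predU1P[->|->]; rewrite ?ltxx ?subrr ?EFinB.
rewrite ge0_integral_mscale//=.
by congr (_ * _)%E; rewrite /nu ge0_integral_pushforward.
Qed.

End AffineSubstitution.

(** * Affine change of variables in the plane *)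

Section PlanarAffineSubstitution.
Variable R : realType.
Local Notation mu := (@lebesgue_measure R).
Local Notation mu2 := (mu \x mu)%E.
Implicit Types (p q r s x y u v : R) (g : R * R -> \bar R).

Lemma measurable_affine2 x p q :
  measurable_fun [set: R * R] (fun z : R * R => x + p * z.1 + q * z.2).
Proof.
apply: measurable_funD; first apply: measurable_funD => //.
  by apply: measurable_funM => //; exact: measurable_fst.
by apply: measurable_funM => //; exact: measurable_snd.
Qed.

Lemma ge0_integral_prod_swap g : measurable_fun [set: R * R] g ->
  (forall z, 0 <= g z)%E ->
  (\int[mu2]_z g z = \int[mu2]_z g (z.2, z.1))%E.
Proof.
move=> mg g0.
rewrite fubini_tonelli1// [RHS]fubini_tonelli2//.
apply: measurableT_comp => //; apply: measurable_fun_pair.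
- exact: measurable_snd.
- exact: measurable_fst.
Qed.

(** For [s != 0] the map factors into two one-variable substitutions, of ratios [(p s - q r) / s]
    and [s]. Tonelli's theorem lets each be done as an inner integral, and the two ratios multiply
    to the determinant. *)
Lemma ge0_integral_planar_affine g x y p q r s :
  p * s - q * r != 0 -> measurable_fun [set: R * R] g ->
  (forall z, 0 <= g z)%E ->
  (\int[mu2]_z g z = `|p * s - q * r|%:E *
    \int[mu2]_z g ((x + p * z.1 + q * z.2)%R, (y + r * z.1 + s * z.2)%R))%E.
Proof.
move=> d0 mg g0.
wlog s0 : p q r s d0 / s != 0.
  (* If [s = 0] then [r != 0]. Exchanging the two variables swaps the columns, puts [r] in the place
     of [s] and only changes the sign of the determinant. *)
  move=> gen; have [s0|] := eqVneq s 0; last exact: gen.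
  have r0 : r != 0 by apply: contra_neq d0 => ->; rewrite s0; ring.
  rewrite (gen q p s r)//; last first.
    by apply: contra_neq d0 => d0; rewrite -[RHS]oppr0 -[in RHS]d0; ring.
  rewrite (_ : p * s - q * r = - (q * r - p * s)) ?normrN; last by ring.
  congr (_ * _)%E.
  rewrite ge0_integral_prod_swap//=; last first.
    by apply: measurableT_comp => //; apply: measurable_fun_pair;
      exact: measurable_affine2.
  by apply: eq_integral => z _; congr (g (_, _)); ring.
(* [h (u, w)] is [g] after the substitution in the first coordinate with the second coordinate [w]
   held fixed. Its shift is chosen so that [w = y + r u + s v] gives the first coordinate
   [x + p u + q v]. *)
pose h (z : R * R) : \bar R :=
  g (((p * s - q * r) / s * z.1 + (x + q * (z.2 - y) / s))%R, z.2).
have mh : measurable_fun [set: R * R] h.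
  apply: measurableT_comp => //; apply: measurable_fun_pair => //.
  rewrite (_ : (fun _ => _) = fun z : R * R =>
    (x - q * y / s) + ((p * s - q * r) / s) * z.1 + (q / s) * z.2).
    exact: measurable_affine2.
  by apply/funext => z; field.
rewrite fubini_tonelli2// /fubini_G.
transitivity (\int[mu]_v (`|(p * s - q * r) / s|%:E * \int[mu]_u h (u, v)))%E.
  apply: eq_integral => v _.
  have k0 : (p * s - q * r) / s != 0 by rewrite mulf_neq0 ?invr_eq0.
  rewrite (@ge0_integral_affine _ (fun u => g (u, v)) _ (x + q * (v - y) / s) k0)//.
  exact: measurable_fun_pair1.
rewrite ge0_integralZl//; last 2 first.
- by have := @measurable_fun_fubini_tonelli_G _ _ _ _ R mu h mh; apply => z; exact: g0.
- by move=> v _; apply: integral_ge0 => u _; exact: g0.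
rewrite -fubini_tonelli//; last by move=> z; exact: g0.
(* What remains is the second substitution, [w = s v + (y + r u)] for fixed [u]. *)
rewrite [X in (_ * X = _)%E](_ : _ =
   `|s|%:E * \int[mu]_u \int[mu]_v h (u, s * v + (y + r * u))%R)%E.
  rewrite muleA -EFinM -normrM divfK//; congr (_ * _)%E.
  rewrite fubini_tonelli1//; last first.
    by apply: measurableT_comp => //; apply: measurable_fun_pair;
      exact: measurable_affine2.
  apply: eq_integral => u _; apply: eq_integral => v _.
  by rewrite /h/=; congr (g (_, _)); [field|ring].
rewrite -ge0_integralZl//; last 2 first.
- rewrite -[X in measurable_fun _ X]/(fubini_F mu
    (fun z : R * R => h (z.1, (s * z.2 + (y + r * z.1))%R))).
  apply: measurable_fun_fubini_tonelli_F; last by move=> z; exact: g0.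
  apply: measurableT_comp => //; apply: measurable_fun_pair; first exact: measurable_fst.
  rewrite (_ : (fun _ => _) = fun z : R * R => y + r * z.1 + s * z.2).
    exact: measurable_affine2.
  by apply/funext => z; ring.
- by move=> u _; apply: integral_ge0 => v _; exact: g0.
apply: eq_integral => u _.
rewrite (@ge0_integral_affine _ (fun v => h (u, v)) _ (y + r * u) s0).
- by [].
- exact: measurable_fun_pair2 mh.
- by move=> v; exact: g0.
Qed.

End PlanarAffineSubstitution.

(** * Supporting lines and Jensen's inequality for the weight [u du] *)

Section WeightedJensen.
Variable R : realType.
Local Notation mu := (@lebesgue_measure R).
Implicit Types (c h : R -> R) (m x y t u w : R).

(** Every difference quotient to the left of [w] is at most every one to the right. The supremum of
    the left quotients therefore separates the two families and serves as slope. *)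
Lemma supporting_line c w : 0 < w < 1 ->
  (forall x y, 0 <= x <= 1 -> 0 <= y <= 1 -> forall t, 0 <= t <= 1 ->
    c ((1 - t) * x + t * y) <= (1 - t) * c x + t * c y) ->
  exists m, forall u, 0 <= u <= 1 -> c w + m * (u - w) <= c u.
Proof.
move=> /andP[w0 w1] cvx.
have slope x y : 0 <= x < w -> w < y <= 1 ->
    (c w - c x) / (w - x) <= (c y - c w) / (y - w).
  move=> /andP[x0 xw] /andP[wy y1].
  have yx : 0 < y - x by lra.
  have : c ((1 - (w - x) / (y - x)) * x + (w - x) / (y - x) * y) <=
      (1 - (w - x) / (y - x)) * c x + (w - x) / (y - x) * c y.
    apply: cvx; [lra|lra|].
    by rewrite ler_pdivlMr// mul0r ler_pdivrMr// mul1r; apply/andP; lra.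
  have -> : (1 - (w - x) / (y - x)) * x + (w - x) / (y - x) * y = w.
    by field; lra.
  have -> : (1 - (w - x) / (y - x)) * c x + (w - x) / (y - x) * c y =
            ((y - w) * c x + (w - x) * c y) / (y - x) by field; lra.
  rewrite ler_pdivlMr// => H.
  rewrite ler_pdivrMr ?subr_gt0// mulrAC ler_pdivlMr ?subr_gt0//.
  nra.
pose S := [set (c w - c x) / (w - x) | x in [set x | 0 <= x < w]].
have Sub y : w < y <= 1 -> ubound S ((c y - c w) / (y - w)).
  by move=> wy _ [x /= xw <-]; exact: slope.
have S0 : S !=set0 by exists ((c w - c 0) / (w - 0)); exists 0; rewrite //= lexx.
have hsS : has_sup S.
  by split => //; exists ((c 1 - c w) / (1 - w)); apply: Sub; rewrite w1 lexx.
exists (sup S) => u /andP[u0 u1].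
have [uw|wu|->] := ltgtP u w; last by rewrite subrr mulr0 addr0.
- have : (c w - c u) / (w - u) <= sup S.
    by apply: sup_upper_bound => //; exists u; rewrite //= u0 uw.
  rewrite ler_pdivrMr ?subr_gt0//; nra.
- have : sup S <= (c u - c w) / (u - w).
    by apply: ge_sup => //; apply: Sub; rewrite wu u1.
  rewrite ler_pdivlMr ?subr_gt0//; nra.
Qed.

Lemma oo01P u : `]0, 1[%classic u -> 0 < u < 1.
Proof. by rewrite /= in_itv. Qed.

Lemma integral_deriv_horner (p : {poly R}) :
  (\int[mu]_(x in `[0%R, 1%R]) (p^`().[x])%:E = (p.[1] - p.[0])%:E)%E.
Proof.
rewrite (@continuous_FTC2 _ (horner p^`()) (horner p) 0 1) ?EFinB//.
- by apply: continuous_in_subspaceT => x _; exact: continuous_horner.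
- split.
  + by move=> x _; exact: derivable_horner.
  + by apply: cvg_at_right_filter; exact: continuous_horner.
  + by apply: cvg_at_left_filter; exact: continuous_horner.
- by move=> x _; rewrite -derivE.
Qed.

(* [2 u du] is a probability on [0, 1] with barycenter [2 / 3]. *)
Lemma weighted_jensen c : measurable_fun (`]0, 1[%classic : set R) c ->
  (forall u, 0 <= u <= 1 -> 0 <= c u) ->
  (forall x y, 0 <= x <= 1 -> 0 <= y <= 1 -> forall t, 0 <= t <= 1 ->
    c ((1 - t) * x + t * y) <= (1 - t) * c x + t * c y) ->
  ((c (2 / 3) / 2)%:E <= \int[mu]_(u in `]0%R, 1%R[) (u * c u)%:E)%E.
Proof.
move=> mc c0 cvx.
have /(@supporting_line c (2 / 3))/(_ cvx)[m cm] : 0 < (2 / 3 : R) < 1 by apply/andP; lra.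
set A := c (2 / 3) in cm *.
have A0 : 0 <= A by apply: c0; apply/andP; lra.
(* A primitive of [u (A + m (u - 2 / 3)) + |m|], the weighted supporting line plus a constant. The
   slope term integrates to 0, since [2 / 3] is the barycenter. The constant [|m|], added to both
   sides, makes the lower integrand nonnegative, so that monotonicity of nonnegative integrals
   applies. *)
pose p : {poly R} := (m / 3)%:P * 'X^3 + ((A - m * (2 / 3)) / 2)%:P * 'X^2
  + `|m|%:P * 'X.
have dp u : p^`().[u] = u * (A + m * (u - 2 / 3)) + `|m|.
  by rewrite /p !poly.derivE/= !hornerE/=; field.
have p01 : p.[1] - p.[0] = A / 2 + `|m|.
  by rewrite /p !hornerE/=; field.
have mI : measurable (`]0, 1[%classic : set R) by [].
have q0 u : 0 < u < 1 -> 0 <= p^`().[u].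
  move=> /andP[u0 u1]; rewrite dp.
  have := ler_norm m; have := ler_norm (- m); rewrite normrN => m1 m2.
  have uA : 0 <= u * A by rewrite mulr_ge0// ltW.
  have k1 : -1 <= u * (u - 2 / 3) by nra.
  have k2 : u * (u - 2 / 3) <= 1 by nra.
  nra.
rewrite -(@leeD2rE _ `|m|%:E)// -EFinD -p01 -integral_deriv_horner.
have mp : measurable_fun (`]0, 1[%classic : set R) (EFin \o horner p^`()).
  apply/measurable_EFinP; apply: measurable_funTS.
  by apply: continuous_measurable_fun; exact: continuous_horner.
rewrite integral_itv_bndoo//.
have -> : (\int[mu]_(u in `]0%R, 1%R[) (u * c u)%:E + `|m|%:E =
    \int[mu]_(u in `]0%R, 1%R[) ((u * c u)%:E + `|m|%:E))%E.
  rewrite ge0_integralD//=.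
  - by rewrite integral_cst//= lebesgue_measure_itv/= lte01 oppr0 adde0 mule1.
  - by move=> u /oo01P /andP[u0 u1]; rewrite lee_fin mulr_ge0 ?c0 ?ltW.
  - by apply/measurable_EFinP; exact: measurable_funM.
apply: ge0_le_integral => //.
- by apply/measurable_EFinP; apply: measurable_funD => //; exact: measurable_funM.
- move=> u /oo01P /andP[u0 u1].
  rewrite -EFinD lee_fin dp lerD2r ler_pM2l//.
  by apply: cm; rewrite !ltW.
Qed.

End WeightedJensen.

(** * Barycentric coordinates; boundedness and measurability of convex functions on triangles *)

Section Triangles.
Variable R : realType.
Implicit Types (X Y Z p : pt R) (f : pt R -> R) (a s t u l : R).

Lemma fstD (v w : pt R) : (v + w).1 = v.1 + w.1. Proof. by []. Qed.
Lemma sndD (v w : pt R) : (v + w).2 = v.2 + w.2. Proof. by []. Qed.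
Lemma fstN (v : pt R) : (- v).1 = - v.1. Proof. by []. Qed.
Lemma sndN (v : pt R) : (- v).2 = - v.2. Proof. by []. Qed.
Lemma fstZ (k : R) (v : pt R) : (k *: v).1 = k * v.1. Proof. by []. Qed.
Lemma sndZ (k : R) (v : pt R) : (k *: v).2 = k * v.2. Proof. by []. Qed.
Definition coordE := (fstD, sndD, fstN, sndN, fstZ, sndZ).

Lemma pt_eq (v w : pt R) : v.1 = w.1 -> v.2 = w.2 -> v = w.
Proof. by case: v w => [v1 v2] [w1 w2] /= -> ->. Qed.

Definition cross (v w : pt R) : R := v.1 * w.2 - v.2 * w.1.

(** The barycentric coordinate of [p] at the first listed vertex [X], as a quotient of signed areas.
    Cyclic shifts of the vertices give the other two coordinates, with the same denominator by
    [cross_cycle]. *)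
Definition bary X Y Z p : R := cross (Y - p) (Z - p) / cross (Y - X) (Z - X).

(** Strict inequalities make the four triangles of the parallelogram pairwise disjoint. *)
Definition open_triangle X Y Z : set (pt R) :=
  [set p | [/\ 0 < bary X Y Z p, 0 < bary Y Z X p & 0 < bary Z X Y p]].

Lemma cross_cycle X Y Z : cross (Z - Y) (X - Y) = cross (Y - X) (Z - X).
Proof. by rewrite /cross !coordE; ring. Qed.

Lemma bary_sum X Y Z p : cross (Y - X) (Z - X) != 0 ->
  bary X Y Z p + bary Y Z X p + bary Z X Y p = 1.
Proof.
move=> d0; rewrite /bary (cross_cycle Y Z X) !(cross_cycle X Y Z).
by rewrite -!mulrDl; apply: (canLR (mulfK d0)); rewrite mul1r /cross !coordE; ring.
Qed.

Lemma bary_recombine X Y Z p : cross (Y - X) (Z - X) != 0 ->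
  bary X Y Z p *: X + bary Y Z X p *: Y + bary Z X Y p *: Z = p.
Proof.
move=> d0; rewrite /bary (cross_cycle Y Z X) !(cross_cycle X Y Z).
by move: d0; rewrite /cross !coordE => d0; apply: pt_eq; rewrite !coordE; field.
Qed.

Lemma bary_comb X Y Z s t u : cross (Y - X) (Z - X) != 0 -> s + t + u = 1 ->
  bary X Y Z (s *: X + t *: Y + u *: Z) = s.
Proof.
move=> d0 stu; rewrite /bary; apply: (canLR (mulfK d0)).
rewrite (_ : s = 1 - t - u); last by rewrite -stu; ring.
by rewrite /cross !coordE; ring.
Qed.

Lemma bary_comb2 X Y Z s t u : cross (Y - X) (Z - X) != 0 -> s + t + u = 1 ->
  bary Y Z X (s *: X + t *: Y + u *: Z) = t.
Proof.
rewrite -cross_cycle => d0 stu; rewrite -addrA addrC (bary_comb d0)//.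
by rewrite -stu; ring.
Qed.

Lemma bary_comb3 X Y Z s t u : cross (Y - X) (Z - X) != 0 -> s + t + u = 1 ->
  bary Z X Y (s *: X + t *: Y + u *: Z) = u.
Proof.
rewrite -cross_cycle -cross_cycle => d0 stu; rewrite addrC addrA (bary_comb d0)//.
by rewrite -stu; ring.
Qed.

Lemma triangleP X Y Z p : cross (Y - X) (Z - X) != 0 ->
  triangle X Y Z p <->
  [/\ 0 <= bary X Y Z p, 0 <= bary Y Z X p & 0 <= bary Z X Y p].
Proof.
move=> d0; split.
  move=> [s [t [u [s0 t0 u0 stu ->]]]].
  by rewrite bary_comb// bary_comb2// bary_comb3.
move=> [b1 b2 b3]; exists (bary X Y Z p), (bary Y Z X p), (bary Z X Y p).
by split => //; [exact: bary_sum|rewrite bary_recombine].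
Qed.

Lemma measurable_bary X Y Z : measurable_fun [set: R * R] (bary X Y Z).
Proof.
rewrite (_ : bary X Y Z = fun p =>
    cross Y Z / cross (Y - X) (Z - X) +
    (Y.2 - Z.2) / cross (Y - X) (Z - X) * p.1 +
    (Z.1 - Y.1) / cross (Y - X) (Z - X) * p.2).
  exact: measurable_affine2.
apply/funext => p; rewrite /bary; set k := (cross (Y - X) _)^-1.
by rewrite /cross !coordE; ring.
Qed.

Lemma measurable_bary_ge X Y Z a : measurable [set p : R * R | a <= bary X Y Z p].
Proof.
have mb : measurable_fun [set: R * R] (bary X Y Z) by exact: measurable_bary.
have := mb measurableT _ (measurable_itv `[a, +oo[).
rewrite setTI; congr measurable; apply/seteqP; split => p /=;
  by rewrite in_itv/= andbT.
Qed.

Lemma measurable_triangle X Y Z : cross (Y - X) (Z - X) != 0 ->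
  measurable (triangle X Y Z : set (R * R)).
Proof.
move=> d0; rewrite (_ : triangle X Y Z = [set p | 0 <= bary X Y Z p] `&`
  [set p | 0 <= bary Y Z X p] `&` [set p | 0 <= bary Z X Y p]).
  by do 2?apply: measurableI; exact: measurable_bary_ge.
apply/seteqP; split => p; first by move=> /triangleP[].
by move=> [[b1 b2] b3]; apply/triangleP.
Qed.

Lemma measurable_open_triangle X Y Z :
  measurable (open_triangle X Y Z : set (R * R)).
Proof.
rewrite (_ : open_triangle X Y Z = [set p | 0 < bary X Y Z p] `&`
  [set p | 0 < bary Y Z X p] `&` [set p | 0 < bary Z X Y p]).
  have mb U V W : measurable [set p : R * R | 0 < bary U V W p].
    have mUVW : measurable_fun [set: R * R] (bary U V W) by exact: measurable_bary.
    have := mUVW measurableT _ (measurable_itv `]0, +oo[).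
    rewrite setTI; congr measurable; apply/seteqP; split => p /=;
      by rewrite in_itv/= andbT.
  by do 2?apply: measurableI; exact: mb.
by apply/seteqP; split => p; [move=> []|move=> [[]]].
Qed.

Lemma open_triangle_comb X Y Z s t u :
  open_triangle X Y Z (s *: X + t *: Y + u *: Z) ->
  cross (Y - X) (Z - X) != 0 -> s + t + u = 1 -> [/\ 0 < s, 0 < t & 0 < u].
Proof. by move=> [+ + +] d0 stu; rewrite bary_comb// bary_comb2// bary_comb3. Qed.

Lemma open_triangle_sub X Y Z : cross (Y - X) (Z - X) != 0 ->
  open_triangle X Y Z `<=` triangle X Y Z.
Proof. by move=> d0 p [/ltW b1 /ltW b2 /ltW b3]; apply/triangleP. Qed.

Lemma convex_on_comb X Y Z f s t u s' t' u' l :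
  convex_on (triangle X Y Z) f ->
  [/\ 0 <= s, 0 <= t, 0 <= u & s + t + u = 1] ->
  [/\ 0 <= s', 0 <= t', 0 <= u' & s' + t' + u' = 1] -> 0 <= l <= 1 ->
  f (((1 - l) * s + l * s') *: X + ((1 - l) * t + l * t') *: Y +
     ((1 - l) * u + l * u') *: Z) <=
  (1 - l) * f (s *: X + t *: Y + u *: Z) + l * f (s' *: X + t' *: Y + u' *: Z).
Proof.
move=> cvx [s0 t0 u0 stu] [s'0 t'0 u'0 stu'] l01.
have := cvx (s *: X + t *: Y + u *: Z) (s' *: X + t' *: Y + u' *: Z) _ _ l l01.
rewrite (_ : (1 - l) *: _ + _ = ((1 - l) * s + l * s') *: X +
  ((1 - l) * t + l * t') *: Y + ((1 - l) * u + l * u') *: Z); last first.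
  by apply: pt_eq; rewrite !coordE; ring.
by apply; [exists s, t, u|exists s', t', u'].
Qed.

(** The bound is the largest vertex value. Convexity is used twice: along the edge [YZ], then from
    [X] to the point of that edge with parameter [u / (t + u)]. The vertex [X] itself, where
    [t + u = 0], is treated apart. *)
Lemma convex_on_triangle_ub X Y Z f : convex_on (triangle X Y Z) f ->
  exists M, forall p, triangle X Y Z p -> f p <= M.
Proof.
move=> cvx; exists (Num.max (f X) (Num.max (f Y) (f Z))).
move=> p [s [t [u [s0 t0 u0 stu ->]]]]; set M := Num.max _ _.
have MX : f X <= M by rewrite le_max lexx.
have MY : f Y <= M by rewrite !le_max lexx orbT.
have MZ : f Z <= M by rewrite !le_max lexx !orbT.
have vX : X = 1 *: X + 0 *: Y + 0 *: Z by rewrite scale1r !scale0r !addr0.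
have vY : Y = 0 *: X + 1 *: Y + 0 *: Z by rewrite scale1r !scale0r add0r addr0.
have vZ : Z = 0 *: X + 0 *: Y + 1 *: Z by rewrite scale1r !scale0r !add0r.
have edge v : 0 <= v <= 1 -> f (0 *: X + (1 - v) *: Y + v *: Z) <= M.
  move=> v01; have := @convex_on_comb X Y Z f 0 1 0 0 0 1 v cvx.
  rewrite !mulr0 !mulr1 !addr0 !add0r -vY -vZ => H.
  apply: le_trans (H _ _ v01) _; [by split; lra|by split; lra|].
  by case/andP: v01 => v0 v1; nra.
have [tu|tu] := eqVneq (t + u) 0.
  have t00 : t = 0 by lra.
  have u00 : u = 0 by lra.
  by rewrite t00 u00 (_ : s = 1) -?vX//; lra.
have tu0 : 0 < t + u by rewrite lt_neqAle eq_sym tu addr_ge0.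
have := @convex_on_comb X Y Z f 1 0 0 0 (1 - u / (t + u)) (u / (t + u)) (t + u) cvx.
have utu : 0 <= u / (t + u) <= 1.
  by rewrite divr_ge0 ?ler_pdivrMr ?mul1r//; lra.
rewrite -vX (_ : (1 - (t + u)) * 1 + (t + u) * 0 = s); last by lra.
rewrite (_ : (1 - (t + u)) * 0 + (t + u) * (1 - u / (t + u)) = t); last by field.
rewrite (_ : (1 - (t + u)) * 0 + (t + u) * (u / (t + u)) = u); last by field.
move=> H; apply: le_trans (H _ _ _) _; [by split; lra|by split; lra|lra|].
have := edge _ utu; move: MX; nra.
Qed.

(** The centroid is [1/3 p + 2/3 z], where [z] has coordinates [(1 - s) / 2], [(1 - t) / 2],
    [(1 - u) / 2] and so stays in the triangle. Convexity and the upper bound [M] at [z] bound [f p]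
    from below. *)
Lemma convex_on_triangle_lb X Y Z f : convex_on (triangle X Y Z) f ->
  exists m, forall p, triangle X Y Z p -> m <= f p.
Proof.
move=> cvx; have [M fM] := convex_on_triangle_ub cvx.
exists (3 * f (3^-1 *: X + 3^-1 *: Y + 3^-1 *: Z) - 2 * M).
move=> p [s [t [u [s0 t0 u0 stu ->]]]].
have := @convex_on_comb X Y Z f s t u ((1 - s) / 2) ((1 - t) / 2) ((1 - u) / 2)
  (2 / 3) cvx.
have -> : (1 - 2 / 3) * s + 2 / 3 * ((1 - s) / 2) = 3^-1 by field.
have -> : (1 - 2 / 3) * t + 2 / 3 * ((1 - t) / 2) = 3^-1 by field.
have -> : (1 - 2 / 3) * u + 2 / 3 * ((1 - u) / 2) = 3^-1 by field.
set z := _ + ((1 - u) / 2) *: Z => H.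
have fz : f z <= M.
  by apply: fM; exists ((1 - s) / 2), ((1 - t) / 2), ((1 - u) / 2); split => //; lra.
have {H} : f (3^-1 *: X + 3^-1 *: Y + 3^-1 *: Z) <=
    (1 - 2 / 3) * f (s *: X + t *: Y + u *: Z) + 2 / 3 * f z.
  by apply: H; [split|split; lra|apply/andP; lra].
lra.
Qed.

(* A convex function on a simplex is upper semicontinuous, even at the boundary
   points: [f < a] at [p] propagates to all points of the triangle whose
   barycentric coordinates exceed those of [p] scaled by some factor [l < 1]. *)
Lemma convex_on_triangle_usc X Y Z f a p : cross (Y - X) (Z - X) != 0 ->
  convex_on (triangle X Y Z) f -> triangle X Y Z p -> f p < a ->
  exists2 l, 0 <= l < 1 & forall y, triangle X Y Z y ->
    l * bary X Y Z p <= bary X Y Z y -> l * bary Y Z X p <= bary Y Z X y ->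
    l * bary Z X Y p <= bary Z X Y y -> f y < a.
Proof.
move=> d0 cvx Tp fpa; have [M0 fM0] := convex_on_triangle_ub cvx.
pose M := Num.max M0 a.
have fM z : triangle X Y Z z -> f z <= M by move=> /fM0; rewrite le_max => ->.
have aM : a <= M by rewrite le_max lexx orbT.
have MF : 0 < M - f p by lra.
(* Chosen so that [f p + k (M - f p)] is the midpoint of [f p] and [a], hence below [a]. The bound
   [k <= 1/2] keeps the factor [l = 1 - k] in [[0, 1[]. *)
pose k := (a - f p) / (M - f p) / 2.
have k0 : 0 < k by rewrite !divr_gt0// subr_gt0.
have k1 : k <= 2^-1.
  by rewrite /k ler_piMl// ler_pdivrMr// mul1r lerD2r.
have kE : k * (M - f p) = (a - f p) / 2 by rewrite /k; field; rewrite gt_eqF.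
exists (1 - k); first by apply/andP; lra.
move=> y Ty; have [y1 y2 y3] := (triangleP _ d0).1 Ty.
have [p1 p2 p3] := (triangleP _ d0).1 Tp.
have ys := bary_sum y d0; have ps := bary_sum p d0.
have yE := bary_recombine y d0; have pE := bary_recombine p d0.
move: y1 y2 y3 p1 p2 p3 ys ps yE pE.
set b1 := bary X Y Z y; set b2 := bary Y Z X y; set b3 := bary Z X Y y.
set c1 := bary X Y Z p; set c2 := bary Y Z X p; set c3 := bary Z X Y p.
move=> y1 y2 y3 p1 p2 p3 ys ps yE pE h1 h2 h3.
(* Here [y = (1 - k) p + k z] with [z = (y - (1 - k) p) / k]. The three assumptions on the
   coordinates of [y] say exactly that those of [z] are nonnegative. *)
have := @convex_on_comb X Y Z f c1 c2 c3 ((b1 - (1 - k) * c1) / k)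
  ((b2 - (1 - k) * c2) / k) ((b3 - (1 - k) * c3) / k) k cvx.
have kN0 : k != 0 by rewrite gt_eqF.
rewrite pE.
have -> : (1 - k) * c1 + k * ((b1 - (1 - k) * c1) / k) = b1 by field.
have -> : (1 - k) * c2 + k * ((b2 - (1 - k) * c2) / k) = b2 by field.
have -> : (1 - k) * c3 + k * ((b3 - (1 - k) * c3) / k) = b3 by field.
rewrite yE; set z := _ + (_ / k) *: Z => H.
have sum1 : (b1 - (1 - k) * c1) / k + (b2 - (1 - k) * c2) / k +
    (b3 - (1 - k) * c3) / k = 1.
  rewrite -!mulrDl; apply: (canLR (mulfK kN0)); rewrite mul1r.
  have -> : b1 - (1 - k) * c1 + (b2 - (1 - k) * c2) + (b3 - (1 - k) * c3) =
    (b1 + b2 + b3) - (1 - k) * (c1 + c2 + c3) by ring.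
  by rewrite ys ps; ring.
have z1 : 0 <= (b1 - (1 - k) * c1) / k by rewrite divr_ge0 ?subr_ge0// ltW.
have z2 : 0 <= (b2 - (1 - k) * c2) / k by rewrite divr_ge0 ?subr_ge0// ltW.
have z3 : 0 <= (b3 - (1 - k) * c3) / k by rewrite divr_ge0 ?subr_ge0// ltW.
have fz : f z <= M.
  by apply: fM; exists ((b1 - (1 - k) * c1) / k), ((b2 - (1 - k) * c2) / k),
    ((b3 - (1 - k) * c3) / k).
have {}H : f y <= (1 - k) * f p + k * f z.
  by apply: H; [split|split|apply/andP; lra].
nra.
Qed.

(** For [c > 0] this is density of the rationals. For [c = 0], which occurs at boundary points of
    the triangle, the interval reduces to the rational point 0; this is why the inequalities are
    weak. *)
Lemma rat_between_scaled l c : 0 <= l < 1 -> 0 <= c ->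
  exists q : rat, l * c <= ratr q <= c.
Proof.
move=> /andP[l0 l1]; rewrite le_eqVlt => /predU1P[<-|c0].
  by exists 0; rewrite mulr0 raddf0 lexx.
have lc : l * c < c by rewrite gtr_pMl.
have [q] := rat_in_itvoo lc; rewrite in_itv/= => /andP[q1 q2].
by exists q; rewrite !ltW.
Qed.

(** By [convex_on_triangle_usc], each point of [f < a] lies in a set cut out of the triangle by
    lower bounds on the three barycentric coordinates, on all of which [f < a]. The bounds can be
    taken rational, so countably many such sets suffice. *)
Lemma measurable_convex_on_triangle X Y Z f : cross (Y - X) (Z - X) != 0 ->
  convex_on (triangle X Y Z) f ->
  measurable_fun (triangle X Y Z : set (R * R)) f.
Proof.
move=> d0 cvx.
move=> mT; apply: (measurability _ (RGenInftyO.measurableE R)) => // _ [_ [a ->] <-].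
pose U (q : rat * rat * rat) : set (R * R) := triangle X Y Z `&`
  [set p | ratr q.1.1 <= bary X Y Z p] `&` [set p | ratr q.1.2 <= bary Y Z X p]
  `&` [set p | ratr q.2 <= bary Z X Y p].
have mU q : measurable (U q).
  by do 3?apply: measurableI; by [exact: measurable_triangle|exact: measurable_bary_ge].
(* The union runs over all rational triples; those whose set [U q] is not contained in [f < a]
   contribute the empty set. *)
rewrite (_ : _ `&` _ = \bigcup_q
    (if `[< forall p, U q p -> f p < a >] then U q else set0)); last first.
  apply/seteqP; split => p /=.
    rewrite in_itv/= => -[Tp fpa].
    have [l l01 lP] := convex_on_triangle_usc d0 cvx Tp fpa.
    have [b1 b2 b3] := (triangleP _ d0).1 Tp.
    have [q1 /andP[lq1 qb1]] := rat_between_scaled l01 b1.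
    have [q2 /andP[lq2 qb2]] := rat_between_scaled l01 b2.
    have [q3 /andP[lq3 qb3]] := rat_between_scaled l01 b3.
    exists (q1, q2, q3) => //; case: asboolP => [_|]; first by [].
    case=> y [[[Ty y1] y2] y3].
    by apply: lP => //; [exact: le_trans y1|exact: le_trans y2|exact: le_trans y3].
  move=> [q _]; case: asboolP => // Ua Up.
  by rewrite in_itv/= Ua//; split => //; case: Up => [[[]]].
apply: countable_bigcupT_measurable => [|q]; first exact: countableP.
by case: asboolP => _; [exact: mU|exact: measurable0].
Qed.

End Triangles.

(** * Integral over a triangle against the homothetic segment, for nonnegative [f] *)

Section TriangleSegment.
Variable R : realType.
Local Notation mu := (@lebesgue_measure R).
Local Notation mu2 := (mu \x mu)%E.
Variables (X Y Z : pt R) (f : pt R -> R).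
Hypothesis d0 : cross (Y - X) (Z - X) != 0.
Hypothesis cvx : convex_on (triangle X Y Z) f.
Hypothesis f0 : forall p, triangle X Y Z p -> 0 <= f p.

(** Fixing [u] gives a parallel to [YZ], with [u = 2/3] carrying the homothetic segment. Putting
    [v = u t] with [t] fixed gives the ray from [X] through [Y + t (Z - Y)]. *)
Let phi (z : R * R) : pt R := X + z.1 *: (Y - X) + z.2 *: (Z - Y).

(** Extension by 0 outside the open triangle allows the substitution rules to be applied on the
    whole plane. *)
Let K : R * R -> \bar R := (EFin \o f) \_ (open_triangle X Y Z) \o phi.

Let phiE u v : phi (u, v) = (1 - u) *: X + (u - v) *: Y + v *: Z.
Proof. by apply: pt_eq; rewrite /phi !coordE/=; ring. Qed.

Let phi_open u v : open_triangle X Y Z (phi (u, v)) <-> 0 < v /\ v < u /\ u < 1.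
Proof.
rewrite phiE /open_triangle/= bary_comb ?bary_comb2 ?bary_comb3//; try ring.
rewrite !subr_gt0; split; first by case.
by case=> ? [].
Qed.

Let K_in u v : 0 < v -> v < u -> u < 1 -> K (u, v) = (f (phi (u, v)))%:E.
Proof.
by move=> v0 vu u1; rewrite /K /= patchE mem_set//; apply/phi_open.
Qed.

Let K_out u v : ~ (0 < v /\ v < u /\ u < 1) -> K (u, v) = 0%E.
Proof. by move=> H; rewrite /K /= patchE memNset// => /phi_open. Qed.

Let K_ge0 z : (0 <= K z)%E.
Proof.
rewrite /K/= patchE; case: ifPn => // /set_mem /(open_triangle_sub d0) Tz.
by rewrite lee_fin f0.
Qed.

Let restrict_ge0 z : (0 <= ((EFin \o f) \_ (open_triangle X Y Z)) z)%E.
Proof.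
rewrite patchE; case: ifPn => // /set_mem /(open_triangle_sub d0) Tz.
by rewrite lee_fin f0.
Qed.

Let measurable_f_open :
  measurable_fun [set: R * R] ((EFin \o f) \_ (open_triangle X Y Z)).
Proof.
apply/(measurable_restrictT _ _).1; first exact: measurable_open_triangle.
apply/measurable_EFinP; apply: measurable_funS (measurable_convex_on_triangle d0 cvx).
  exact: measurable_triangle.
exact: open_triangle_sub.
Qed.

Let phi_coord z : phi z =
  ((X.1 + (Y - X).1 * z.1 + (Z - Y).1 * z.2)%R,
   (X.2 + (Y - X).2 * z.1 + (Z - Y).2 * z.2)%R).
Proof. by apply: pt_eq; rewrite /phi !coordE/=; ring. Qed.

Let measurable_phi : measurable_fun [set: R * R] (phi : R * R -> R * R).
Proof.
rewrite (_ : phi = fun z : R * R =>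
  ((X.1 + (Y - X).1 * z.1 + (Z - Y).1 * z.2)%R,
   (X.2 + (Y - X).2 * z.1 + (Z - Y).2 * z.2)%R)); last first.
  by apply/funext => z; exact: phi_coord.
by apply: measurable_fun_pair; exact: measurable_affine2.
Qed.

Let measurable_K : measurable_fun [set: R * R] K.
Proof. exact: measurableT_comp measurable_f_open measurable_phi. Qed.

(** The linear part of [phi] has columns [Y - X] and [Z - Y]; its determinant is
    [cross (Y - X) (Z - X)]. *)
Let integral_K : (\int[mu2]_(p in open_triangle X Y Z) (f p)%:E =
  `|cross (Y - X) (Z - X)|%:E * \int[mu2]_z K z)%E.
Proof.
rewrite integral_mkcond.
have dE : (Y - X).1 * (Z - Y).2 - (Z - Y).1 * (Y - X).2 = cross (Y - X) (Z - X).
  by rewrite /cross !coordE; ring.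
have := @ge0_integral_planar_affine _ _ X.1 X.2 (Y - X).1 (Z - Y).1 (Y - X).2
  (Z - Y).2 _ measurable_f_open restrict_ge0.
rewrite dE => /(_ d0) H; apply: etrans H _.
by congr (_ * _)%E; apply: eq_integral => z _; rewrite /K/= phi_coord.
Qed.

(** The integrand after [v = u t], with Jacobian [u]. The Jacobian is truncated at 0 so that [W] is
    nonnegative on the whole plane; for [u <= 0] the factor [K] vanishes. *)
Let W (z : R * R) : \bar R := ((Num.max z.1 0)%:E * K (z.1, (z.1 * z.2)%R))%E.

Let W_ge0 z : (0 <= W z)%E.
Proof. by rewrite /W mule_ge0// lee_fin le_max lexx orbT. Qed.

Let measurable_W : measurable_fun [set: R * R] W.
Proof.
apply: emeasurable_funM.
  apply/measurable_EFinP; apply: measurable_maxr; first exact: measurable_fst.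
  exact: measurable_cst.
apply: measurableT_comp => //; apply: measurable_fun_pair; first exact: measurable_fst.
by apply: measurable_funM; [exact: measurable_fst|exact: measurable_snd].
Qed.

(* Blow-up [v = u t] of the apex of the triangle [0 < v < u < 1]. *)
Let integral_blowup : (\int[mu2]_z K z = \int[mu2]_z W z)%E.
Proof.
apply: etrans (@fubini_tonelli1 _ _ _ _ R mu mu K measurable_K K_ge0) _.
apply: etrans _ (esym (@fubini_tonelli1 _ _ _ _ R mu mu W measurable_W W_ge0)).
apply: eq_integral => u _; rewrite /fubini_F.
have [u0|u0] := ltP 0 u.
  have uN0 : u != 0 by rewrite gt_eqF.
  rewrite (@ge0_integral_affine _ (fun v => K (u, v)) _ 0 uN0
    (measurable_fun_pair2 u measurable_K) (fun v => K_ge0 (u, v))).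
  have mKu : measurable_fun [set: R] (fun t => K (u, (u * t + 0)%R)).
    apply: (measurableT_comp measurable_K); apply: measurable_fun_pair => //.
    exact: measurable_affine.
  have u0E : (0 <= u%:E)%E by rewrite lee_fin ltW.
  rewrite gtr0_norm//.
  rewrite -(@ge0_integralZl _ _ _ mu _ measurableT _ mKu u%:E (fun t _ => K_ge0 _) u0E).
  by apply: eq_integral => t _; rewrite /W/= addr0 max_l// ltW.
(* For [u <= 0] neither [(u, v)] nor [(u, u t)] satisfies [0 < v < u < 1], so both inner integrals
   are 0. *)
rewrite integral0_eq; last by move=> v _; apply: K_out => -[? []]; lra.
rewrite integral0_eq// => t _; rewrite /W/= K_out ?mule0// => -[? []]; lra.
Qed.

Let seg t : pt R := homothety X (2 / 3) Y +
  t *: (homothety X (2 / 3) Z - homothety X (2 / 3) Y).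

Let seg_phi t : seg t = phi (2 / 3, 2 / 3 * t).
Proof.
by apply: pt_eq; rewrite /seg /phi /homothety !coordE/=; ring.
Qed.

(** This is [weighted_jensen] for [f] along the ray of parameter [t], which meets the homothetic
    segment at [u = 2/3]. Convexity in [u] is inherited because [phi (u, u t)] is affine in [u]. *)
Let jensen_ray t : 0 < t < 1 ->
  ((f (seg t))%:E * (2^-1)%:E <= \int[mu]_u W (u, t))%E.
Proof.
move=> /andP[t0 t1].
pose c u := f (phi (u, u * t)).
have K_c u : 0 < u < 1 -> K (u, u * t) = (c u)%:E.
  by move=> /andP[u0 u1]; rewrite K_in//; nra.
have Tphi u : 0 <= u <= 1 -> triangle X Y Z (phi (u, u * t)).
  move=> /andP[u0 u1]; rewrite phiE; exists (1 - u), (u - u * t), (u * t).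
  by split=> //; nra.
have mI : measurable (`]0, 1[%classic : set R) by [].
have mc : measurable_fun (`]0, 1[%classic : set R) c.
  apply/measurable_EFinP.
  have mKt : measurable_fun (`]0, 1[%classic : set R) (fun u => K (u, u * t)).
    apply: measurable_funTS; apply: (measurableT_comp measurable_K).
    by apply: measurable_fun_pair => //; exact: measurable_funM.
  by apply: eq_measurable_fun mKt => u /set_mem /oo01P u01; rewrite /= K_c.
rewrite seg_phi -EFinM; apply: le_trans (weighted_jensen mc _ _) _.
- by move=> u u01; exact/f0/Tphi.
- move=> x y x01 y01 l l01.
  have := cvx (Tphi _ x01) (Tphi _ y01) l01.
  rewrite /c (_ : _ *: _ + _ = phi ((1 - l) * x + l * y, ((1 - l) * x + l * y) * t))//.
  by apply: pt_eq; rewrite /phi !coordE/=; ring.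
rewrite integral_mkcond; apply: ge0_le_integral => //.
- move=> u _; rewrite patchE; case: ifPn => // /set_mem /oo01P /andP[u0 u1].
  by rewrite lee_fin; apply: mulr_ge0; [exact: ltW|apply/f0/Tphi; rewrite !ltW].
- apply/(measurable_restrictT _ _).1 => //; apply/measurable_EFinP.
  exact: measurable_funM.
- exact: measurable_fun_pair1 measurable_W.
move=> u _; rewrite patchE; case: ifPn => [/set_mem /oo01P u01|_]; last exact: W_ge0.
rewrite /W/= K_c// max_l; last by case/andP: u01 => /ltW.
by rewrite -EFinM.
Qed.

(** Integrate [jensen_ray] over [0 < t < 1], with [u] as inner variable. The mass 1/2 of [u du] on
    [[0, 1]] times the Jacobian of [phi] is the area of the triangle. *)
Lemma triangle_segment_le :
  ((`|cross (Y - X) (Z - X)| / 2)%:E *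
    \int[mu]_(t in `[0%R, 1%R]) (f (seg t))%:E <=
   \int[mu2]_(p in open_triangle X Y Z) (f p)%:E)%E.
Proof.
have mseg : measurable_fun (`]0, 1[%classic : set R) (EFin \o f \o seg).
  have mKt : measurable_fun (`]0, 1[%classic : set R)
      (fun t => K (2 / 3, 2 / 3 * t)).
    apply: measurable_funTS; apply: (measurableT_comp measurable_K).
    by apply: measurable_fun_pair => //; exact: measurable_funM.
  apply: eq_measurable_fun mKt => t /set_mem /oo01P /andP[t0 t1].
  by rewrite /= seg_phi K_in//; lra.
have seg_ge0 t : 0 < t < 1 -> 0 <= f (seg t).
  move=> /andP[t0 t1]; apply: f0; rewrite seg_phi phiE.
  by exists (1 - 2 / 3), (2 / 3 - 2 / 3 * t), (2 / 3 * t); split=> //; lra.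
rewrite integral_itv_bndoo// integral_K EFinM -muleA; apply: lee_wpmul2l => //.
rewrite integral_blowup (@fubini_tonelli2 _ _ _ _ R mu mu W measurable_W W_ge0).
rewrite -ge0_integralZl//.
rewrite integral_mkcond; apply: ge0_le_integral => //.
- move=> t _; rewrite patchE; case: ifPn => // /set_mem /oo01P /seg_ge0 ?.
  by rewrite mule_ge0 ?lee_fin ?invr_ge0.
- by apply/(measurable_restrictT _ _).1 => //; exact: measurable_funeM.
- exact: measurable_fun_fubini_tonelli_G.
move=> t _; rewrite patchE; case: ifPn => [/set_mem /oo01P t01|_].
  by rewrite muleC; exact: jensen_ray.
by apply: integral_ge0 => u _; exact: W_ge0.
Qed.

End TriangleSegment.

(** * Relabelling of vertices, integrability, and removal of the sign condition on [f] *)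

Section ShiftedTriangle.
Variable R : realType.
Local Notation mu := (@lebesgue_measure R).
Local Notation mu2 := (mu \x mu)%E.
Implicit Types (X Y Z P Q p : pt R) (f : pt R -> R) (m : R).

Lemma triangle_swapl X Y Z : triangle Y X Z = triangle X Y Z.
Proof.
apply/seteqP; split => p [s [t [u [s0 t0 u0 stu ->]]]]; exists t, s, u;
  by split=> //; rewrite (addrC t, addrC (t *: _)).
Qed.

Lemma triangle_swapr X Y Z : triangle X Z Y = triangle X Y Z.
Proof.
apply/seteqP; split => p [s [t [u [s0 t0 u0 stu ->]]]]; exists s, u, t;
  by split=> //; rewrite addrAC.
Qed.

Lemma bary_swap X Y Z p : bary X Z Y p = bary X Y Z p.
Proof.
have crossC v w : cross v w = - cross w v :> R by rewrite /cross; ring.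
by rewrite /bary (crossC (Z - p)) (crossC (Z - X)) invrN mulrNN.
Qed.

Lemma open_triangle_swapl X Y Z : open_triangle Y X Z = open_triangle X Y Z.
Proof.
by apply/seteqP; split => p []; rewrite /open_triangle/=
  (bary_swap Y) (bary_swap X) (bary_swap Z) => ? ? ?; split.
Qed.

Lemma open_triangle_swapr X Y Z : open_triangle X Z Y = open_triangle X Y Z.
Proof.
by apply/seteqP; split => p []; rewrite /open_triangle/=
  (bary_swap X) (bary_swap Y) (bary_swap Z) => ? ? ?; split.
Qed.

Lemma convex_onB (S : set (pt R)) f m : convex_on S f ->
  convex_on S (fun p => f p - m).
Proof. by move=> cvx x y Sx Sy t t01; have := cvx x y Sx Sy t t01; nra. Qed.

Lemma bounded_integrable d (T : measurableType d)
    (nu : {measure set T -> \bar R}) (D : set T) (f : T -> R) m M :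
  measurable D -> (nu D < +oo)%E -> measurable_fun D f ->
  (forall x, D x -> m <= f x <= M) -> nu.-integrable D (EFin \o f).
Proof.
move=> mD nD mf fmM; apply: measurable_bounded_integrable => //.
exists (`|m| + `|M|); split=> // N mMN x Dx /=.
have /andP[mf1 fM] := fmM x Dx.
have := ler_norm M; have := ler_norm (- m); rewrite normrN => h1 h2.
have := normr_ge0 m; have := normr_ge0 M => h3 h4.
by rewrite ler_norml; apply/andP; lra.
Qed.

(** The segment stays in the triangle, where [f] is measurable and bounded on both sides.
    Integrability is what lets constants be subtracted inside the real-valued integral [avg_seg]. *)
Lemma segment_integrable X Y Z P Q f : cross (Y - X) (Z - X) != 0 ->
  convex_on (triangle X Y Z) f -> triangle X Y Z P -> triangle X Y Z Q ->
  mu.-integrable `[0, 1] (EFin \o (fun t => f (P + t *: (Q - P)))).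
Proof.
move=> d0 cvx TP TQ.
have seg t : 0 <= t <= 1 -> triangle X Y Z (P + t *: (Q - P)).
  move: TP TQ => [s [r [u [s0 r0 u0 sru ->]]]] [s' [r' [u' [s'0 r'0 u'0 sru' ->]]]].
  move=> /andP[t0 t1]; exists ((1 - t) * s + t * s'), ((1 - t) * r + t * r'),
    ((1 - t) * u + t * u').
  split; [nra|nra|nra| |by apply: pt_eq; rewrite !coordE; ring].
  transitivity ((1 - t) * (s + r + u) + t * (s' + r' + u')); first by ring.
  by rewrite sru sru'; ring.
have [M fM] := convex_on_triangle_ub cvx.
have [m mf] := convex_on_triangle_lb cvx.
have in01 t : `[0, 1]%classic t -> 0 <= t <= 1 by rewrite /= in_itv.
apply: (@bounded_integrable _ _ _ _ _ m M) => //.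
- by rewrite /= lebesgue_measure_itv/= lte01 oppr0 adde0 ltry.
- apply: (@measurable_comp _ _ _ _ _ _ (triangle X Y Z : set (R * R))
    (f : R * R -> R) _ (fun t : R => P + t *: (Q - P) : R * R)).
  + exact: measurable_triangle.
  + by move=> _ [t /in01 t01 <-]; exact: seg.
  + exact: measurable_convex_on_triangle.
  + apply: measurable_funTS.
    rewrite (_ : (fun _ => _) = fun t : R =>
        ((Q - P).1 * t + P.1, (Q - P).2 * t + P.2)).
      by apply: measurable_fun_pair; exact: measurable_affine.
    by apply/funext => t; apply: pt_eq; rewrite !coordE/=; ring.
- by move=> t /in01 /seg Tt; rewrite mf// fM.
Qed.

(** Apply the nonnegative case to [f - m]. Since [avg_seg] integrates over a parameter interval of
    length 1, the shift lowers the segment average by exactly [m]. *)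
Lemma triangle_avg_seg_le X Y Z f m : cross (Y - X) (Z - X) != 0 ->
  convex_on (triangle X Y Z) f ->
  (forall p, triangle X Y Z p -> m <= f p) ->
  ((`|cross (Y - X) (Z - X)| / 2 *
    (avg_seg (homothety X (2 / 3) Y) (homothety X (2 / 3) Z) f - m))%:E <=
   \int[mu2]_(p in open_triangle X Y Z) (f p - m)%:E)%E.
Proof.
move=> d0 cvx mf.
apply: le_trans (triangle_segment_le d0 (convex_onB m cvx) _); last first.
  by move=> p Tp; rewrite subr_ge0 mf.
set P := homothety X _ Y; set Q := homothety X _ Z.
have TP : triangle X Y Z P.
  exists (1 - 2 / 3), (2 / 3), 0; split; [lra|lra|lra|lra|].
  by apply: pt_eq; rewrite /P /homothety !coordE; ring.
have TQ : triangle X Y Z Q.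
  exists (1 - 2 / 3), 0, (2 / 3); split; [lra|lra|lra|lra|].
  by apply: pt_eq; rewrite /Q /homothety !coordE; ring.
have intf := segment_integrable d0 cvx TP TQ.
have intF := segment_integrable d0 (convex_onB m cvx) TP TQ.
rewrite EFinM lee_wpmul2l//.
have -> : avg_seg P Q f - m =
    Rintegral mu `[0, 1] (fun t => f (P + t *: (Q - P)) - m).
  have mI : measurable (`[0, 1]%classic : set R) by [].
  rewrite RintegralB//.
    congr (_ - _); rewrite Rintegral_cst//= lebesgue_measure_itv/= lte01 oppr0 adde0.
    by rewrite mulr1.
  apply: (@bounded_integrable _ _ _ _ _ m m) => //.
  - by rewrite /= lebesgue_measure_itv/= lte01 oppr0 adde0 ltry.
  - by move=> x _; rewrite lexx.
by rewrite /Rintegral fineK//; exact: integrable_fin_num.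
Qed.

End ShiftedTriangle.

(** * Decomposition of the parallelogram by its diagonals *)

Section Parallelogram.
Variable R : realType.
Local Notation mu := (@lebesgue_measure R).
Local Notation mu2 := (mu \x mu)%E.
Variables (A B D : pt R).
Hypothesis d0 : cross (B - A) (D - A) != 0.

Let C : pt R := B + D - A.
Let O : pt R := (2^-1 : R) *: (A + C).
Let d := cross (B - A) (D - A).
Let par : set (R * R) := parallelogram_region A B D.

(** [sig] and [tau] are the affine coordinates in the frame [(A; B - A, D - A)], read off as
    barycentric coordinates at [B] and [D] in the triangle [ABD]. The diagonals are [sig = tau] and
    [sig + tau = 1]. *)
Let sig (p : pt R) : R := bary B D A p.
Let tau (p : pt R) : R := bary D A B p.

Let sigtau p : p = A + sig p *: (B - A) + tau p *: (D - A).
Proof.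
have := bary_sum p d0 => s1; rewrite -[LHS](bary_recombine p d0).
rewrite /sig /tau.
have -> : bary A B D p = 1 - bary B D A p - bary D A B p by rewrite -s1; ring.
by apply: pt_eq; rewrite !coordE; ring.
Qed.

Let sig_comb s t : sig (A + s *: (B - A) + t *: (D - A)) = s.
Proof.
rewrite /sig (_ : _ + _ = (1 - s - t) *: A + s *: B + t *: D).
  by rewrite bary_comb2//; ring.
by apply: pt_eq; rewrite !coordE; ring.
Qed.

Let tau_comb s t : tau (A + s *: (B - A) + t *: (D - A)) = t.
Proof.
rewrite /tau (_ : _ + _ = (1 - s - t) *: A + s *: B + t *: D).
  by rewrite bary_comb3//; ring.
by apply: pt_eq; rewrite !coordE; ring.
Qed.

Lemma parallelogramP p : par p <-> 0 <= sig p <= 1 /\ 0 <= tau p <= 1.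
Proof.
split; first by move=> [s [t [s01 t01 ->]]]; rewrite sig_comb tau_comb.
by move=> [s01 t01]; exists (sig p), (tau p); split=> //; exact: sigtau.
Qed.

Lemma measurable_parallelogram : measurable par.
Proof.
have itvE (g : R * R -> R) : measurable_fun [set: R * R] g ->
    measurable [set p | 0 <= g p <= 1].
  move=> /(_ measurableT _ (measurable_itv `[0, 1])); rewrite setTI.
  by congr measurable; apply/seteqP; split => p /=; rewrite in_itv.
rewrite (_ : par = [set p | 0 <= sig p <= 1] `&` [set p | 0 <= tau p <= 1]).
  by apply: measurableI; apply: itvE; exact: measurable_bary.
by apply/seteqP; split => p /parallelogramP.
Qed.

(** The affine frame pulls the indicator of the parallelogram back to that of the unit square, of
    measure 1; the determinant is [d]. *)
Lemma measure_parallelogram : mu2 par = `|d|%:E.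
Proof.
have mpar := measurable_parallelogram.
have m1 : measurable_fun [set: R * R] (fun p : R * R => (\1_par p)%:E : \bar R).
  by apply/measurable_EFinP; exact: measurable_indic.
have := @ge0_integral_planar_affine _ _ A.1 A.2 (B - A).1 (D - A).1 (B - A).2
  (D - A).2 _ m1.
have -> : (B - A).1 * (D - A).2 - (D - A).1 * (B - A).2 = d.
  by rewrite /d /cross; ring.
move=> /(_ d0); rewrite integral_indic// setIT => ->; last first.
  by move=> z; rewrite lee_fin.
have mI : measurable (`[0, 1]%classic : set R) by [].
have mQ : mu2 (`[0%R, 1%R]%classic `*` `[0%R, 1%R]%classic) = 1%E.
  rewrite product_measure1E//= lebesgue_measure_itv/= lte01 oppr0 adde0.
  by rewrite mule1.
rewrite (_ : (\int[_]_z _)%E = (\int[mu2]_z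
    (\1_(`[0%R, 1%R]%classic `*` `[0%R, 1%R]%classic : set (R * R)) z)%:E)%E).
  rewrite integral_indic//; last exact: measurableX.
  by rewrite setIT -[RHS]mule1 -mQ.
apply: eq_integral => -[s t] _ /=; congr (_%:E); rewrite !indicE; congr (_ %:R).
rewrite (_ : (_, _) = A + s *: (B - A) + t *: (D - A)); last first.
  by apply: pt_eq; rewrite !coordE/=; ring.
apply: congr1; apply/idP/idP => /set_mem H; apply/mem_set.
  by move/parallelogramP: H; rewrite sig_comb tau_comb /= !in_itv.
by apply/parallelogramP; rewrite sig_comb tau_comb; move: H; rewrite /= !in_itv.
Qed.

(** With the vertices in the order used here, the four triangles have the same signed double area
    [- d / 2], hence equal areas [|d| / 4]. *)
Let cross_AOB : cross (O - A) (B - A) = - (d / 2).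
Proof. by rewrite /O /C /d /cross !coordE; field. Qed.
Let cross_BOC : cross (O - B) (C - B) = - (d / 2).
Proof. by rewrite /O /C /d /cross !coordE; field. Qed.
Let cross_COD : cross (O - C) (D - C) = - (d / 2).
Proof. by rewrite /O /C /d /cross !coordE; field. Qed.
Let cross_DOA : cross (O - D) (A - D) = - (d / 2).
Proof. by rewrite /O /C /d /cross !coordE; field. Qed.

Let dN0 : - (d / 2) != 0.
Proof. by rewrite oppr_eq0 mulf_neq0. Qed.

Let AOB_E p : p = (1 - sig p - tau p) *: A + (2 * tau p) *: O + (sig p - tau p) *: B.
Proof. by rewrite {1}(sigtau p); apply: pt_eq; rewrite /O /C !coordE; field. Qed.
Let BOC_E p :
  p = (sig p - tau p) *: B + (2 * (1 - sig p)) *: O + (sig p + tau p - 1) *: C.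
Proof. by rewrite {1}(sigtau p); apply: pt_eq; rewrite /O /C !coordE; field. Qed.
Let COD_E p :
  p = (sig p + tau p - 1) *: C + (2 * (1 - tau p)) *: O + (tau p - sig p) *: D.
Proof. by rewrite {1}(sigtau p); apply: pt_eq; rewrite /O /C !coordE; field. Qed.
Let DOA_E p : p = (tau p - sig p) *: D + (2 * sig p) *: O + (1 - sig p - tau p) *: A.
Proof. by rewrite {1}(sigtau p); apply: pt_eq; rewrite /O /C !coordE; field. Qed.

Let regionE := (cross_AOB, cross_BOC, cross_COD, cross_DOA).

Let open_AOB p : open_triangle A O B p ->
  [/\ 0 < 1 - sig p - tau p, 0 < 2 * tau p & 0 < sig p - tau p].
Proof.
rewrite {1}(AOB_E p) => /open_triangle_comb; rewrite cross_AOB.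
by apply => //; ring.
Qed.
Let open_BOC p : open_triangle B O C p ->
  [/\ 0 < sig p - tau p, 0 < 2 * (1 - sig p) & 0 < sig p + tau p - 1].
Proof.
rewrite {1}(BOC_E p) => /open_triangle_comb; rewrite cross_BOC.
by apply => //; ring.
Qed.
Let open_COD p : open_triangle C O D p ->
  [/\ 0 < sig p + tau p - 1, 0 < 2 * (1 - tau p) & 0 < tau p - sig p].
Proof.
rewrite {1}(COD_E p) => /open_triangle_comb; rewrite cross_COD.
by apply => //; ring.
Qed.
Let open_DOA p : open_triangle D O A p ->
  [/\ 0 < tau p - sig p, 0 < 2 * sig p & 0 < 1 - sig p - tau p].
Proof.
rewrite {1}(DOA_E p) => /open_triangle_comb; rewrite cross_DOA.
by apply => //; ring.
Qed.

Local Notation four_triangles :=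
  ((triangle A O B `|` triangle B O C) `|` (triangle C O D `|` triangle D O A)).

Let parallelogram_cover p : par p ->
  four_triangles p.
Proof.
move/parallelogramP => [/andP[s0 s1] /andP[t0 t1]].
have [ts|st] := leP (tau p) (sig p); have [st1|st1] := leP (sig p + tau p) 1.
- left; left; rewrite (AOB_E p).
  by exists (1 - sig p - tau p), (2 * tau p), (sig p - tau p); split=> //; lra.
- left; right; rewrite (BOC_E p).
  by exists (sig p - tau p), (2 * (1 - sig p)), (sig p + tau p - 1); split=> //; lra.
- right; right; rewrite (DOA_E p).
  by exists (tau p - sig p), (2 * sig p), (1 - sig p - tau p); split=> //; lra.
- right; left; rewrite (COD_E p).
  by exists (sig p + tau p - 1), (2 * (1 - tau p)), (tau p - sig p); split=> //; lra.
Qed.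

(** The open triangles lie strictly on different sides of the diagonals, hence are disjoint. As [g]
    is nonnegative, their inclusion in the parallelogram gives the inequality, and the measure of
    the diagonals never enters. *)
Let ge0_integral_open_triangles_le (g : R * R -> \bar R) : measurable_fun par g ->
  (forall p, par p -> 0 <= g p)%E ->
  (\int[mu2]_(p in open_triangle A O B) g p + \int[mu2]_(p in open_triangle B O C) g p
   + (\int[mu2]_(p in open_triangle C O D) g p + \int[mu2]_(p in open_triangle D O A) g p)
   <= \int[mu2]_(p in par) g p)%E.
Proof.
move=> mg g0.
have mo X Y Z : measurable (open_triangle X Y Z : set (R * R)).
  exact: measurable_open_triangle.
have mpar := measurable_parallelogram.
have s1 : open_triangle A O B `|` open_triangle B O C `<=` par.
  move=> p [/open_AOB|/open_BOC] [h1 h2 h3]; apply/parallelogramP;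
    by split; apply/andP; lra.
have s2 : open_triangle C O D `|` open_triangle D O A `<=` par.
  move=> p [/open_COD|/open_DOA] [h1 h2 h3]; apply/parallelogramP;
    by split; apply/andP; lra.
have s12 : (open_triangle A O B `|` open_triangle B O C) `|`
    (open_triangle C O D `|` open_triangle D O A) `<=` par by rewrite subUset.
have m1 : measurable (open_triangle A O B `|` open_triangle B O C : set (R * R)).
  by apply: measurableU.
have m2 : measurable (open_triangle C O D `|` open_triangle D O A : set (R * R)).
  by apply: measurableU.
have mgS (S : set (R * R)) : measurable S -> S `<=` par -> measurable_fun S g.
  by move=> _ Spar; exact: measurable_funS mg.
have g0S (S : set (R * R)) : S `<=` par -> forall p, S p -> (0 <= g p)%E.
  by move=> Spar p /Spar; exact: g0.
have disj1 : [disjoint open_triangle A O B & open_triangle B O C].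
  by apply/disj_setPS => p [/open_AOB [h1 h2 h3] /open_BOC [h4 h5 h6]]; lra.
have disj2 : [disjoint open_triangle C O D & open_triangle D O A].
  by apply/disj_setPS => p [/open_COD [h1 h2 h3] /open_DOA [h4 h5 h6]]; lra.
have disj12 : [disjoint open_triangle A O B `|` open_triangle B O C &
    open_triangle C O D `|` open_triangle D O A].
  apply/disj_setPS => p [[/open_AOB|/open_BOC] [h1 h2 h3]];
    by move=> [/open_COD|/open_DOA] [h4 h5 h6]; lra.
have E1 := ge0_integral_setU mu2 (mo A O B) (mo B O C) (mgS _ m1 s1) (g0S _ s1) disj1.
have E2 := ge0_integral_setU mu2 (mo C O D) (mo D O A) (mgS _ m2 s2) (g0S _ s2) disj2.
have m12 := measurableU _ _ m1 m2.
have E := ge0_integral_setU mu2 m1 m2 (mgS _ m12 s12) (g0S _ s12) disj12.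
rewrite -E1 -E2 -E.
exact: (ge0_subset_integral mu2 m12 mpar mg g0 s12).
Qed.

Section Average.
Variable f : pt R -> R.
Hypothesis cAOB : convex_on (triangle A O B) f.
Hypothesis cBOC : convex_on (triangle B O C) f.
Hypothesis cCOD : convex_on (triangle C O D) f.
Hypothesis cDOA : convex_on (triangle D O A) f.

(** The closed triangles cover the parallelogram, and [f] is measurable on each of them by
    convexity. *)
Let measurable_f : measurable_fun par f.
Proof.
apply: (measurable_funS _ (fun p => @parallelogram_cover p)).
  by do ?apply: measurableU; apply: measurable_triangle; rewrite regionE.
by do 2?[apply/measurable_funU; [..|split]]; do ?apply: measurableU;
  (apply: measurable_triangle || apply: measurable_convex_on_triangle) => //;
  rewrite regionE.
Qed.

Let f_bounds : exists m M, forall p, four_triangles p ->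
  m <= f p <= M.
Proof.
have [m1 mf1] := convex_on_triangle_lb cAOB.
have [m2 mf2] := convex_on_triangle_lb cBOC.
have [m3 mf3] := convex_on_triangle_lb cCOD.
have [m4 mf4] := convex_on_triangle_lb cDOA.
have [M1 fM1] := convex_on_triangle_ub cAOB.
have [M2 fM2] := convex_on_triangle_ub cBOC.
have [M3 fM3] := convex_on_triangle_ub cCOD.
have [M4 fM4] := convex_on_triangle_ub cDOA.
exists (Num.min (Num.min m1 m2) (Num.min m3 m4)).
exists (Num.max (Num.max M1 M2) (Num.max M3 M4)).
move=> p [[]|[]] Tp; rewrite !ge_min !le_max.
- by rewrite mf1// fM1.
- by rewrite mf2// fM2// !orbT.
- by rewrite mf3// fM3// !orbT.
- by rewrite mf4// fM4// !orbT.
Qed.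

(** [s1], ..., [s4] stand for the segment averages attached to the four triangles, so that both
    choices of apices are handled at once. The hypothesis ranges over all lower bounds [m], since a
    concrete one is only produced inside the proof. *)
Lemma avg_parallelogram_ge (s1 s2 s3 s4 : R) :
  (forall m, (forall p, four_triangles p ->
      m <= f p) ->
    [/\ ((`|d| / 4 * (s1 - m))%:E <= \int[mu2]_(p in open_triangle A O B) (f p - m)%:E)%E,
     ((`|d| / 4 * (s2 - m))%:E <= \int[mu2]_(p in open_triangle B O C) (f p - m)%:E)%E,
     ((`|d| / 4 * (s3 - m))%:E <= \int[mu2]_(p in open_triangle C O D) (f p - m)%:E)%E &
     ((`|d| / 4 * (s4 - m))%:E <= \int[mu2]_(p in open_triangle D O A) (f p - m)%:E)%E])
  -> (s1 + s2 + s3 + s4) / 4 <= avg2 par f.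
Proof.
have [m [M fmMU]] := f_bounds.
have fmM p : par p -> m <= f p <= M by move=> /parallelogram_cover/fmMU.
have mfU p : four_triangles p -> m <= f p by move=> /fmMU /andP[].
have mpar := measurable_parallelogram.
have parE := measure_parallelogram.
have par_fin : (mu2 par < +oo)%E by rewrite parE ltry.
have mf p : par p -> m <= f p by move=> /fmM /andP[].
move=> /(_ m mfU)[h1 h2 h3 h4].
pose nu : {measure set (measurableTypeR R * measurableTypeR R) -> \bar R} := mu2.
have intf : mu2.-integrable par (EFin \o f) by
    exact: (@bounded_integrable _ _ _ nu _ _ m M mpar par_fin measurable_f fmM).
have intm : mu2.-integrable par (EFin \o cst m).
  by apply: (@bounded_integrable _ _ _ nu _ _ m m mpar par_fin) => // p _; rewrite lexx.
have mF : measurable_fun par (fun p => (f p - m)%:E).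
  by apply/measurable_EFinP; exact: measurable_funB.
have F0 p : par p -> (0 <= (f p - m)%:E)%E.
  by move=> /mf; rewrite lee_fin subr_ge0.
have := ge0_integral_open_triangles_le mF F0.
move=> /(le_trans (leeD (leeD h1 h2) (leeD h3 h4))).
have -> : (\int[mu2]_(p in par) (f p - m)%:E)%E =
    (Rintegral mu2 par f - m * `|d|)%:E.
  have -> : m * `|d| = Rintegral mu2 par (cst m).
    by rewrite Rintegral_cst//; congr (_ * _); rewrite [X in fine X]parE.
  rewrite -RintegralB// /Rintegral fineK//.
  apply: integrable_fin_num => //.
  apply: (@bounded_integrable _ _ _ nu _ (fun p => f p - m) 0 (M - m) mpar par_fin).
    exact: measurable_funB.
  by move=> p /fmM /andP[mfp fMp]; apply/andP; lra.
(* The shift cancels: four terms [|d| / 4 * m] on the left against [m * |d|] on the right. *)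
rewrite -!EFinD lee_fin => H.
rewrite /avg2 /leb2 [X in fine X]parE ler_pdivlMr ?normr_gt0//=.
by move: H; clear nu intf intm; lra.
Qed.

End Average.
End Parallelogram.

(** * The two inequalities, from two choices of apices *)

Theorem theorem3p4 (R : realType) (A B C D : pt R) (f : pt R -> R) :
  (* ABCD is a (non-degenerate) parallelogram *)
  C = B + D - A ->
  (B - A).1 * (D - A).2 - (B - A).2 * (D - A).1 != 0 ->
  let O := (2^-1 : R) *: (A + C) in
  convex_on (triangle A O B) f ->
  convex_on (triangle B O C) f ->
  convex_on (triangle C O D) f ->
  convex_on (triangle D O A) f ->
  let h := fun a x => homothety a (2 / 3 : R) x in
  let A' := h O A in let B' := h O B in let C' := h O C in let D' := h O D in
  let K := h D A in let L := h D O in let M := h D C in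
  let P := h B A in let Q := h B O in let Rr := h B C in
  let avgP := avg2 (parallelogram_region A B D) f in
  (avg_seg K L f + avg_seg L M f + avg_seg P Q f + avg_seg Q Rr f) / 4 <= avgP /\
  (avg_seg A' B' f + avg_seg B' C' f + avg_seg C' D' f + avg_seg D' A' f) / 4 <= avgP.
Proof.
move=> -> d0 O cAOB cBOC cCOD cDOA h A' B' C' D' K L M P Q Rr avgP.
pose d := cross (B - A) (D - A).
have dN0 : `|d| / 2 != 0 by rewrite mulf_neq0 ?normr_eq0.
(* The apex must be listed first in [triangle_avg_seg_le], while the decomposition fixes another
   order of the vertices. Relabelling preserves the closed and open triangles and can only change
   the sign of the cross product. *)
have seg X Y Z X1 Y1 Z1 m : triangle X Y Z = triangle X1 Y1 Z1 ->
    open_triangle X Y Z = open_triangle X1 Y1 Z1 ->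
    cross (Y - X) (Z - X) = d / 2 \/ cross (Y - X) (Z - X) = - (d / 2) ->
    convex_on (triangle X1 Y1 Z1) f ->
    (forall p, triangle X1 Y1 Z1 p -> m <= f p) ->
    ((`|d| / 4 * (avg_seg (h X Y) (h X Z) f - m))%:E <=
     \int[(@lebesgue_measure R \x @lebesgue_measure R)%E]_(p in
       open_triangle X1 Y1 Z1) (f p - m)%:E)%E.
  move=> <- <- crossE cvx mf.
  have nE : `|cross (Y - X) (Z - X)| = `|d| / 2.
    by case: crossE => ->; rewrite ?normrN normrM (@ger0_norm _ 2^-1).
  have d1 : cross (Y - X) (Z - X) != 0 by rewrite -normr_eq0 nE.
  have := triangle_avg_seg_le d1 cvx mf.
  by rewrite nE (_ : `|d| / 2 / 2 = `|d| / 4)//; field.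
split.
- rewrite (_ : _ + _ + _ + _ = avg_seg P Q f + avg_seg Q Rr f + avg_seg L M f +
    avg_seg K L f); last by ring.
  apply: avg_parallelogram_ge => // m mf; split.
  + apply: (seg B A O) => //.
    * by rewrite triangle_swapl triangle_swapr.
    * by rewrite open_triangle_swapl open_triangle_swapr.
    * by right; rewrite /d /O /cross !coordE; field.
    * by move=> p Tp; apply: mf; left; left.
  + apply: (seg B O (B + D - A)) => //.
    * by right; rewrite /d /O /cross !coordE; field.
    * by move=> p Tp; apply: mf; left; right.
  + apply: (seg D O (B + D - A)) => //.
    * by rewrite triangle_swapl triangle_swapr triangle_swapl.
    * by rewrite open_triangle_swapl open_triangle_swapr open_triangle_swapl.
    * by left; rewrite /d /O /cross !coordE; field.
    * by move=> p Tp; apply: mf; right; left.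
  + apply: (seg D A O) => //.
    * by rewrite triangle_swapr.
    * by rewrite open_triangle_swapr.
    * by left; rewrite /d /O /cross !coordE; field.
    * by move=> p Tp; apply: mf; right; right.
(* With apex [O] in every triangle, the sides of [A'B'C'D'] already come in the order of the
   decomposition. *)
- apply: avg_parallelogram_ge => // m mf; split.
  + apply: (seg O A B) => //.
    * by rewrite triangle_swapl.
    * by rewrite open_triangle_swapl.
    * by left; rewrite /d /O /cross !coordE; field.
    * by move=> p Tp; apply: mf; left; left.
  + apply: (seg O B (B + D - A)) => //.
    * by rewrite triangle_swapl.
    * by rewrite open_triangle_swapl.
    * by left; rewrite /d /O /cross !coordE; field.
    * by move=> p Tp; apply: mf; left; right.
  + apply: (seg O (B + D - A) D) => //.
    * by rewrite triangle_swapl.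
    * by rewrite open_triangle_swapl.
    * by left; rewrite /d /O /cross !coordE; field.
    * by move=> p Tp; apply: mf; right; left.
  + apply: (seg O D A) => //.
    * by rewrite triangle_swapl.
    * by rewrite open_triangle_swapl.
    * by left; rewrite /d /O /cross !coordE; field.
    * by move=> p Tp; apply: mf; right; right.
Qed.
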